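(* For all $(n_1,k_1),(n_2,k_2)\in\omega^2$: $I^{n_1}P^{k_1}\preceq I^{n_2}P^{k_2}$ if and only if $(n_2,k_2)\leq_{\Pi}(n_1,k_1)$, where $\leq_{\Pi}$ is the product order on $\omega^2$ (i.e. $n_2\le n_1$ and $k_2\le k_1$). Therefore $(\{I^nP^k\}_{(n,k)\in\omega^2},\preceq)$ is a lattice.
   Context: $\omega=\{0,1,2,\dots\}$. Let $\mathcal V$ be a countably infinite set of atomic formulas, and let $L(C)$ be the set of formulas freely generated from $\mathcal V$ by the connectives $C=\{\neg,\rightarrow\}$ ($\neg$ unary, $\rightarrow$ binary). For $(n,k)\in\omega^2$, the matrix $M_{(n,k)}$ has the set of truth-values $A_{(n,k)}=\{F_0,F_1,\dots,F_n,T_0,T_1,\dots,T_k\}$ ($n+k+2$ distinct elements), the set of designated values $D_{(n,k)}=\{T_0,\dots,T_k\}$, and the operations: $\neg F_0=T_0$, $\neg T_0=F_0$, $\neg F_r=F_{r-1}$ for $1\le r\le n$, $\neg T_i=T_{i-1}$ for $1\le i\le k$; and $A\rightarrow B=F_0$ if $A\in D_{(n,k)}$ and $B\notin D_{(n,k)}$, $A\rightarrow B=T_0$ otherwise. An $M_{(n,k)}$-valuation is a homomorphism $v:L(C)\to A_{(n,k)}$ (determined by an arbitrary function $\mathcal V\to A_{(n,k)}$). For $\Gamma\cup\{\phi\}\subseteq L(C)$, $\Gamma\models_{(n,k)}\phi$ means: for every $M_{(n,k)}$-valuation $v$, $v(\Gamma)\subseteq D_{(n,k)}$ implies $v(\phi)\in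 D_{(n,k)}$. The logic $I^nP^k$ is the pair $(C,\models_{(n,k)})$. The relation $\preceq$ on $\{I^nP^k\}_{(n,k)\in\omega^2}$ is defined by: $I^{n_1}P^{k_1}\preceq I^{n_2}P^{k_2}$ iff for every $\Gamma\cup\{\phi\}\subseteq L(C)$, $\Gamma\models_{(n_1,k_1)}\phi$ implies $\Gamma\models_{(n_2,k_2)}\phi$. *)

(* Defs.v *)
From Stdlib Require Export Relation_Definitions.
From mathcomp Require Export all_boot all_order.
From mathcomp Require Export boolp classical_sets functions cardinality.

Set Implicit Arguments.
Unset Strict Implicit.
Unset Printing Implicit Defensive.

Local Open Scope classical_set_scope.

Inductive formula (V : Type) : Type :=
  | Atom of V
  | Neg of formula V
  | Imp of formula V & formula V.

(* [Fv r] is F_r for 0 <= r <= n and [Tv i] is T_i for 0 <= i <= k. *)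
Inductive value (n k : nat) : Type :=
  | Fv of 'I_n.+1
  | Tv of 'I_k.+1.
Arguments Fv {n k}.
Arguments Tv {n k}.

Definition designated (n k : nat) : set (value n k) := range Tv.

Definition negv (n k : nat) (a : value n k) : value n k :=
  match a with
  | Fv r => if r == ord0 then Tv ord0 else Fv (inord r.-1)
  | Tv i => if i == ord0 then Fv ord0 else Tv (inord i.-1)
  end.

Definition impv (n k : nat) (a b : value n k) : value n k :=
  if `[< designated a /\ ~ designated b >] then Fv ord0 else Tv ord0.

Record valuation (V : Type) (n k : nat) (v : formula V -> value n k) : Prop := {
  valuation_neg : forall A, v (Neg A) = negv (v A);
  valuation_imp : forall A B, v (Imp A B) = impv (v A) (v B)
}.

(* The signature C is the same for all the logics considered, so a logic is
   identified with its consequence relation. *)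
Definition logic (V : Type) : Type := set (formula V) -> formula V -> Prop.

Definition IP (V : Type) (n k : nat) : logic V := fun Gamma phi =>
  forall v : formula V -> value n k, valuation v ->
    v @` Gamma `<=` @designated n k -> designated (v phi).
Arguments IP : clear implicits.

Definition logic_le (V : Type) (L1 L2 : logic V) : Prop :=
  forall Gamma phi, L1 Gamma phi -> L2 Gamma phi.

(* Logics are compared by Leibniz equality: IP n k and IP n' k' are the same
   member of the family when their consequence relations coincide. *)
Definition IP_family (V : Type) : set (logic V) :=
  [set L | exists n k, L = IP V n k].
Arguments IP_family : clear implicits.

Definition IP_le (V : Type) (L1 L2 : IP_family V) : Prop :=
  logic_le (val L1) (val L2).
Arguments IP_le : clear implicits.

(* MathComp's latticeType needs a boolean order with chosen meet and join;
   here the order is Prop-valued and the bounds are only asserted to exist. *)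
Definition is_sup (T : Type) (R : relation T) (x y z : T) : Prop :=
  [/\ R x z, R y z & forall u, R x u -> R y u -> R z u].

Definition is_inf (T : Type) (R : relation T) (x y z : T) : Prop :=
  [/\ R z x, R z y & forall u, R u x -> R u y -> R u z].

Definition is_lattice (T : Type) (R : relation T) : Prop :=
  [/\ Relation_Definitions.order T R,
      forall x y, exists z, is_sup R x y z &
      forall x y, exists z, is_inf R x y z].

(* Main.v *)
(* The truth-values F_r and T_i are told apart by how many negations leave them
   undesignated, respectively designated.  Hence M_(n,k) cannot make p, ~p, ...,
   ~^(k+1) p all designated, nor p, ~p, ..., ~^(n+1) p all undesignated, whereas
   any matrix with a larger second (first) parameter can.  Conversely, M_(n,k) is
   a submatrix of M_(n',k') when n <= n' and k <= k', so that a countermodel in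
   the smaller matrix is a countermodel in the larger one.  The order on the
   logics is thus the reversed product order, a lattice. *)
Require Import Defs.
From mathcomp Require Import all_boot all_order.
From mathcomp Require Import boolp classical_sets functions cardinality.

Local Open Scope classical_set_scope.

Lemma designated_Tv n k (i : 'I_k.+1) : designated (Tv i : value n k).
Proof. by exists i. Qed.

Lemma not_designated_Fv n k (r : 'I_n.+1) : ~ designated (Fv r : value n k).
Proof. by case. Qed.

Lemma impv_designated n k (a b : value n k) :
  designated (impv a b) <-> (designated a -> designated b).
Proof.
rewrite /impv; case: asboolP => [[da ndb]|nab]; split.
- by move/not_designated_Fv.
- by move=> /(_ da)/ndb.
- by move=> _ da; apply: contrapT => ndb; apply: nab.
- by move=> _; apply: designated_Tv.
Qed.

(** Each of the first [i] negations meets a positive index, hence lowers it by one; the indices stay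
    in range, so [inord] never takes its default value. *)
Lemma iter_negv_Tv n k (i : 'I_k.+1) j : j <= i ->
  iter j (@negv n k) (Tv i) = Tv (inord (i - j)).
Proof.
elim: j => [|j IHj] lji; first by rewrite subn0 inord_val.
have ltk : i - j < k.+1 by apply: leq_ltn_trans (leq_subr _ _) (ltn_ord i).
rewrite iterS IHj ?(ltnW lji) //= -val_eqE /= inordK // subn_eq0 leqNgt lji /=.
by rewrite subnS.
Qed.

Lemma iter_negv_Fv n k (r : 'I_n.+1) j : j <= r ->
  iter j (@negv n k) (Fv r) = Fv (inord (r - j)).
Proof.
elim: j => [|j IHj] ljr; first by rewrite subn0 inord_val.
have ltn : r - j < n.+1 by apply: leq_ltn_trans (leq_subr _ _) (ltn_ord r).
rewrite iterS IHj ?(ltnW ljr) //= -val_eqE /= inordK // subn_eq0 leqNgt ljr /=.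
by rewrite subnS.
Qed.

(** From T_i, [i] negations lead to T_0 and one more to F_0, with i + 1 <= k + 1. *)
Lemma iter_negv_not_designated n k (a : value n k) :
  exists2 j, j <= k.+1 & ~ designated (iter j (@negv n k) a).
Proof.
case: a => [r|i]; first by exists 0 => //; apply: not_designated_Fv.
exists i.+1; first exact: ltn_ord.
rewrite iterS iter_negv_Tv // subnn /= -val_eqE /= inordK //=.
exact: not_designated_Fv.
Qed.

Lemma iter_negv_designated n k (a : value n k) :
  exists2 j, j <= n.+1 & designated (iter j (@negv n k) a).
Proof.
case: a => [r|i]; last by exists 0 => //; apply: designated_Tv.
exists r.+1; first exact: ltn_ord.
rewrite iterS iter_negv_Fv // subnn /= -val_eqE /= inordK //=.
exact: designated_Tv.
Qed.

Fixpoint eval (V : Type) n k (f : V -> value n k) (A : formula V) : value n k :=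
  match A with
  | Atom p => f p
  | Neg A => negv (eval V n k f A)
  | Imp A B => impv (eval V n k f A) (eval V n k f B)
  end.
Arguments eval {V n k}.

Lemma eval_valuation (V : Type) n k (f : V -> value n k) : valuation (eval f).
Proof. by split. Qed.

Lemma valuation_iter_neg (V : Type) n k (v : formula V -> value n k) j A :
  valuation v -> v (iter j (@Neg V) A) = iter j (@negv n k) (v A).
Proof. by move=> vv; elim: j => //= j <-; rewrite (valuation_neg vv). Qed.

(** A formula with value F_0 under every valuation in every matrix, since p -> p always takes the
    value T_0. *)
Definition falsum (V : Type) (p : V) : formula V :=
  Neg (Imp (Atom p) (Atom p)).

Lemma valuation_falsum (V : Type) n k (v : formula V -> value n k) (p : V) :
  valuation v -> ~ designated (v (falsum V p)).
Proof.
move=> vv; rewrite /falsum (valuation_neg vv) (valuation_imp vv) /impv.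
by case: asboolP => [[]//|_] /=; apply: not_designated_Fv.
Qed.

Lemma logic_le_k (V : Type) (p : V) n1 k1 n2 k2 :
  logic_le (IP V n1 k1) (IP V n2 k2) -> k2 <= k1.
Proof.
move=> le12; rewrite leqNgt; apply/negP => lt12.
pose Gamma := [set iter j (@Neg V) (Atom p) | j in [set j | j <= k1.+1]].
(* As k1 < k2, the value T_(k1+1) exists in the second matrix, and its first k1 + 1 negations stay
   designated. *)
pose v := eval (fun _ => Tv (inord k1.+1) : value n2 k2) : formula V -> _.
have vv : valuation v := eval_valuation _ _ _ _.
apply: (@valuation_falsum V n2 k2 v p vv).
(* In the first matrix [Gamma] has no model, so it entails [falsum] vacuously; in the second, [v] is
   a model of it. *)
apply: (le12 Gamma) (vv) _ => [w ww wG|_ [_ [j /= lej <-] <-]].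
  have [j lej []] := iter_negv_not_designated _ _ (w (Atom p)).
  rewrite -valuation_iter_neg //; apply: wG.
  by exists (iter j (@Neg V) (Atom p)) => //; exists j.
rewrite valuation_iter_neg // iter_negv_Tv ?inordK //.
exact: designated_Tv.
Qed.

Lemma logic_le_n (V : Type) (p : V) n1 k1 n2 k2 :
  logic_le (IP V n1 k1) (IP V n2 k2) -> n2 <= n1.
Proof.
move=> le12; rewrite leqNgt; apply/negP => lt12.
(* Implying [falsum] is designated exactly when the antecedent is not, so premises can demand
   undesignated values. *)
pose G j := Imp (iter j (@Neg V) (Atom p)) (falsum V p).
pose Gamma := [set G j | j in [set j | j <= n1.+1]].
pose v := eval (fun _ => Fv (inord n1.+1) : value n2 k2) : formula V -> _.
have vv : valuation v := eval_valuation _ _ _ _.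
apply: (@valuation_falsum V n2 k2 v p vv).
apply: (le12 Gamma) (vv) _ => [w ww wG|_ [_ [j /= lej <-] <-]].
  have [j lej dj] := iter_negv_designated _ _ (w (Atom p)).
  have : designated (w (G j)) by apply: wG; exists (G j) => //; exists j.
  by rewrite (valuation_imp ww) valuation_iter_neg // => /impv_designated; apply.
rewrite /G (valuation_imp vv) valuation_iter_neg // iter_negv_Fv ?inordK //.
by apply/impv_designated => /not_designated_Fv.
Qed.

Section Submatrix.
Variables (n k n' k' : nat) (le_n : n <= n') (le_k : k <= k').

Definition widen_value (a : value n k) : value n' k' :=
  match a with
  | Fv r => Fv (widen_ord (le_n : n.+1 <= n'.+1) r)
  | Tv i => Tv (widen_ord (le_k : k.+1 <= k'.+1) i)
  end.

Lemma designated_widen a : designated (widen_value a) <-> designated a.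
Proof.
case: a => [r|i] /=; first by split=> /not_designated_Fv.
by split=> _; apply: designated_Tv.
Qed.

Lemma widen_value_neg a : widen_value (negv a) = negv (widen_value a).
Proof.
case: a => [r|i] /=; rewrite -!val_eqE /=; case: eqP => _ /=.
- by congr Tv; apply: val_inj.
- have ltr : r.-1 < n.+1 := leq_ltn_trans (leq_pred _) (ltn_ord r).
  by congr Fv; apply: val_inj; rewrite /= !inordK // (leq_trans ltr).
- by congr Fv; apply: val_inj.
- have lti : i.-1 < k.+1 := leq_ltn_trans (leq_pred _) (ltn_ord i).
  by congr Tv; apply: val_inj; rewrite /= !inordK // (leq_trans lti).
Qed.

Lemma widen_value_imp a b :
  widen_value (impv a b) = impv (widen_value a) (widen_value b).
Proof.
rewrite /impv (propext (designated_widen a)) (propext (designated_widen b)).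
by case: asboolP => _ /=; [congr Fv | congr Tv]; apply: val_inj.
Qed.

(** Widening is a homomorphism that preserves and reflects designation, so composing with it turns a
    valuation in the smaller matrix into one in the larger with the same designated formulas. *)
Lemma logic_le_submatrix (V : Type) : logic_le (IP V n' k') (IP V n k).
Proof.
move=> Gamma phi Hphi v vv vG; apply/designated_widen.
apply: (Hphi (widen_value \o v)) => [|_ [A GA <-]].
  split=> [A|A B] /=; first by rewrite (valuation_neg vv) widen_value_neg.
  by rewrite (valuation_imp vv) widen_value_imp.
by apply/designated_widen; apply: vG; exists A.
Qed.

End Submatrix.

Lemma logic_leP (V : Type) (p : V) n1 k1 n2 k2 :
  logic_le (IP V n1 k1) (IP V n2 k2) <-> n2 <= n1 /\ k2 <= k1.
Proof.
split=> [le12|[len lek]]; last exact: logic_le_submatrix.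
by split; [apply: logic_le_n le12 | apply: logic_le_k le12].
Qed.

Lemma IP_le_order (V : Type) : Relation_Definitions.order _ (IP_le V).
Proof.
split=> [L Gamma phi //|L1 L2 L3 le12 le23 Gamma phi /le12/le23 //|].
move=> L1 L2 le12 le21; apply: val_inj.
by apply/funext => Gamma; apply/funext => phi; apply/propext; split; auto.
Qed.

Definition IP_mem (V : Type) n k : IP_family V :=
  exist _ (IP V n k) (mem_set (ex_intro _ n (ex_intro _ k erefl))).

Lemma IP_memP (V : Type) (L : IP_family V) : exists n k, L = IP_mem V n k.
Proof.
have [n [k eL]] := set_mem (valP L).
by exists n, k; apply: val_inj.
Qed.

Lemma IP_le_lattice (V : Type) (p : V) : is_lattice (IP_le V).
Proof.
have leP n1 k1 n2 k2 : IP_le V (IP_mem V n1 k1) (IP_mem V n2 k2) <->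
    n2 <= n1 /\ k2 <= k1 := logic_leP _ p _ _ _ _.
split; first exact: IP_le_order.
  move=> L1 L2; have [n1 [k1 ->]] := IP_memP V L1.
  have [n2 [k2 ->]] := IP_memP V L2.
  (* The order on parameters is reversed: suprema come from minima, infima from maxima. *)
  exists (IP_mem V (minn n1 n2) (minn k1 k2)); split.
  - by apply/leP; rewrite !geq_minl.
  - by apply/leP; rewrite !geq_minr.
  - move=> L; have [n [k ->]] := IP_memP V L.
    move=> /leP[ln1 lk1] /leP[ln2 lk2]; apply/leP.
    by rewrite !leq_min ln1 ln2 lk1 lk2.
move=> L1 L2; have [n1 [k1 ->]] := IP_memP V L1.
have [n2 [k2 ->]] := IP_memP V L2.
exists (IP_mem V (maxn n1 n2) (maxn k1 k2)); split.
- by apply/leP; rewrite !leq_maxl.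
- by apply/leP; rewrite !leq_maxr.
- move=> L; have [n [k ->]] := IP_memP V L.
  move=> /leP[ln1 lk1] /leP[ln2 lk2]; apply/leP.
  by rewrite !geq_max ln1 ln2 lk1 lk2.
Qed.

Theorem proposition2p8 (V : Type) (V_countably_infinite : ([set: V] #= [set: nat])%card) :
  (forall n1 k1 n2 k2 : nat,
     logic_le (IP V n1 k1) (IP V n2 k2) <->
     ((n2, k2) <= (n1, k1) :> (nat *p nat)%type)%O) /\
  is_lattice (IP_le V).
Proof.
(* The separating formulas are built from one atom; were [V] empty, [nat] would be empty too. *)
have /set0P[p _] : [set: V] != set0.
  apply/eqP => V0; move: V_countably_infinite; rewrite V0 => /card_esym.
  by rewrite card_eq0 => /eqP/seteqP[/(_ 0 I)].
split; last exact: IP_le_lattice.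
move=> n1 k1 n2 k2; apply: (iff_trans (logic_leP _ p _ _ _ _)).
by split=> [[ln lk]|/andP[]//]; apply/andP.
Qed.
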